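(* Let $G=(V,E,\sigma,o)$ be a radially symmetric tree with radially symmetric weight $\sigma$. Then $$\mathrm{Mod}_{\infty,\sigma}(\Gamma_\infty)=\begin{cases}\dfrac{1}{\ell_{\sigma^{-1}}(\Gamma_\infty)}&\text{if }\ell_{\sigma^{-1}}(\Gamma_\infty)<\infty,\\[4pt] 0&\text{otherwise.}\end{cases}$$
   Context: A weighted rooted tree $G=(V,E,\sigma,o)$ has root $o$ and weights $\sigma:E\to\mathbb{R}_{>0}$. The generation of an edge $e$ is the number of edges on the unique path from $o$ ending with $e$; $e$ is the parent of $e'$ if they are adjacent and $e'$ has generation one more. A proper infinite tree is infinite, locally finite, and every edge has at least one child; it is radially symmetric if the number of children of an edge depends only on its generation; $\sigma$ is radially symmetric if $\sigma(e)$ depends only on the generation of $e$. A descending path is a path $e_1e_2\cdots$ from $o$ with $e_i$ the parent of $e_{i+1}$; $\Gamma_\infty$ is the set of infinite descending paths. For $\rho:E\to[0,\infty)$, $\ell_\rho(\gamma)=\sum_{e\in\gamma}\rho(e)$ and $\ell_\rho(\Gamma_\infty)=\inf_{\gamma\in\Gamma_\infty}\ell_\rho(\gamma)$; $\ell_{\sigma^{-1}}$ denotes this with $\rho=1/\sigma$. $\mathrm{Adm}(\Gamma_\infty)=\{\rho\ge0:\ell_\rho(\gamma)\ge1\ \forall\gamma\in\Gamma_\infty\}$, $\mathcal{E}_{\infty,\sigma}(\rho)=\sup_{e\in E}\sigma(e)\rho(e)$, $\mathrm{Mod}_{\infty,\sigma}(\Gamma_\infty)=\inf_{\rho\in\mathrm{Adm}(\Gamma_\infty)}\mathcal{E}_{\infty,\sigma}(\rho)$.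 *)

(* Defs.v *)
From HB Require Import structures.
From mathcomp Require Import all_boot all_order all_algebra.
From mathcomp Require Import all_classical all_reals all_analysis.

Set Implicit Arguments.
Unset Strict Implicit.
Unset Printing Implicit Defensive.

Import Order.TTheory GRing.Theory Num.Theory.

Local Open Scope classical_set_scope.
Local Open Scope ring_scope.

(* A graph on V is given by its set of edges E, each edge being an unordered
   pair [set x; y] of distinct vertices. Functions on edges are functions on
   [set V] of which only the values on E matter. *)
Definition simple_graph (V : choiceType) (E : set (set V)) : Prop :=
  forall e, E e -> exists x y : V, x <> y /\ e = [set x; y].

Definition adj (V : choiceType) (E : set (set V)) : rel V :=
  fun x y => [set x; y] \in E.

(* The path with successive vertices x :: p; it has [size p] edges. *)
Definition simple_path (V : choiceType) (E : set (set V)) (x : V) (p : seq V)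
    : bool :=
  path (adj E) x p && uniq (x :: p).

Definition is_tree (V : choiceType) (E : set (set V)) : Prop :=
  simple_graph E /\
  forall x y : V, exists! p : seq V, simple_path E x p /\ last x p = y.

Definition path_ending_with (V : choiceType) (E : set (set V)) (o : V)
    (e : set V) : set (seq V) :=
  [set p | simple_path E o p /\
           exists q y, p = rcons q y /\ e = [set last o q; y]].

(* In a tree [path_ending_with E o e] is a singleton for every edge e, so
   [xget] returns its element; the default [::] is used only off E. *)
Definition generation (V : choiceType) (E : set (set V)) (o : V) (e : set V)
    : nat :=
  size (xget [::] (path_ending_with E o e)).

Definition adjacent_edges (V : choiceType) (e e' : set V) : Prop :=
  e <> e' /\ e `&` e' !=set0.

Definition parent (V : choiceType) (E : set (set V)) (o : V) (e e' : set V)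
    : Prop :=
  [/\ E e, E e', adjacent_edges e e' &
      generation E o e' = (generation E o e).+1].

Definition children (V : choiceType) (E : set (set V)) (o : V) (e : set V)
    : set (set V) :=
  [set e' | parent E o e e'].

Definition locally_finite (V : choiceType) (E : set (set V)) : Prop :=
  forall v : V, finite_set [set e | E e /\ e v].

Definition proper_infinite_tree (V : choiceType) (E : set (set V)) (o : V)
    : Prop :=
  [/\ is_tree E, infinite_set [set: V], locally_finite E &
      forall e, E e -> children E o e !=set0].

Definition radially_symmetric_tree (V : choiceType) (E : set (set V)) (o : V)
    : Prop :=
  proper_infinite_tree E o /\
  forall e e', E e -> E e' -> generation E o e = generation E o e' ->
    (children E o e #= children E o e')%card.

Definition radially_symmetric_weight (R : realType) (V : choiceType)
    (E : set (set V)) (o : V) (sigma : set V -> R) : Prop :=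
  forall e e', E e -> E e' -> generation E o e = generation E o e' ->
    sigma e = sigma e'.

(* Infinite descending paths, as sequences of edges numbered from 0. *)
Definition Gamma_oo (V : choiceType) (E : set (set V)) (o : V)
    : set (nat -> set V) :=
  [set gamma |
    (exists v : nat -> V,
       [/\ v 0%N = o, injective v &
           forall i, E (gamma i) /\ gamma i = [set v i; v i.+1]]) /\
    forall i, parent E o (gamma i) (gamma i.+1)].

(* The edges of a path are pairwise distinct, so summing over indices is
   summing over the edges of gamma. *)
Definition path_length (R : realType) (V : choiceType) (rho : set V -> R)
    (gamma : nat -> set V) : \bar R :=
  (\sum_(0 <= i <oo) (rho (gamma i))%:E)%E.

Definition family_length (R : realType) (V : choiceType) (rho : set V -> R)
    (Gamma : set (nat -> set V)) : \bar R :=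
  ereal_inf [set path_length rho gamma | gamma in Gamma].

Definition Adm (R : realType) (V : choiceType) (E : set (set V))
    (Gamma : set (nat -> set V)) : set (set V -> R) :=
  [set rho | (forall e, E e -> 0 <= rho e) /\
             forall gamma, Gamma gamma -> (1 <= path_length rho gamma)%E].

Definition energy_oo (R : realType) (V : choiceType) (E : set (set V))
    (sigma rho : set V -> R) : \bar R :=
  ereal_sup [set (sigma e * rho e)%:E | e in E].

Definition Mod_oo (R : realType) (V : choiceType) (E : set (set V))
    (sigma : set V -> R) (Gamma : set (nat -> set V)) : \bar R :=
  ereal_inf [set energy_oo E sigma rho | rho in Adm (R := R) E Gamma].

(* Main.v *)
(** Write s for sigma. If rho is admissible and has finite energy r, then
    rho <= r / s on edges, so every descending path gives 1 <= r * l_{1/s};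
    hence r >= 1 / l_{1/s}.  Conversely c / s has energy at most c, and it is
    admissible as soon as c * l_{1/s} >= 1: take c = 1 / l_{1/s} when the length
    is finite, and c arbitrarily small otherwise.  Radial symmetry only serves
    to make l_{1/s} positive, all first edges of descending paths having the
    same weight. *)
Require Import Defs.
From HB Require Import structures.
From mathcomp Require Import all_boot all_order all_algebra.
From mathcomp Require Import all_classical all_reals all_analysis.

Set Implicit Arguments.
Unset Strict Implicit.
Unset Printing Implicit Defensive.

Import Order.TTheory GRing.Theory Num.Theory.

Local Open Scope classical_set_scope.
Local Open Scope ring_scope.

Lemma path_length_scale (R : realType) (V : choiceType) (c : R)
    (f : set V -> R) (gamma : nat -> set V) :
  (forall i, 0 <= f (gamma i)) ->
  path_length (fun e => c * f e) gamma = (c%:E * path_length f gamma)%E.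
Proof.
move=> f_ge0; rewrite /path_length -nneseriesZl => [|i _].
  by apply: eq_eseriesr => i _; rewrite EFinM.
by rewrite lee_fin.
Qed.

Lemma le_path_length (R : realType) (V : choiceType) (f g : set V -> R)
    (gamma : nat -> set V) :
  (forall i, 0 <= f (gamma i) <= g (gamma i)) ->
  (path_length f gamma <= path_length g gamma)%E.
Proof.
move=> fg; apply: lee_nneseries => [i _ _|i _]; rewrite lee_fin.
- by have /andP[] := fg i.
- by have /andP[] := fg i.
Qed.

Lemma path_length_ge_first (R : realType) (V : choiceType) (f : set V -> R)
    (gamma : nat -> set V) :
  (forall i, 0 <= f (gamma i)) -> ((f (gamma 0%N))%:E <= path_length f gamma)%E.
Proof.
move=> f_ge0; rewrite /path_length.
have := @nneseries_lim_ge R (fun i => (f (gamma i))%:E) xpredT 0%N 1%N.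
by rewrite big_nat1; apply => i _ _; rewrite lee_fin.
Qed.

Lemma Gamma_oo_edge (V : choiceType) (E : set (set V)) (o : V)
    (gamma : nat -> set V) (i : nat) : Gamma_oo E o gamma -> E (gamma i).
Proof. by case=> -[v [_ _ /(_ i)[]]]. Qed.

(** The first edge of a path between two distinct vertices is a witness. This excludes the value
    [-oo] of a supremum over no edges, so that energies are nonnegative. *)
Lemma infinite_tree_edge (V : choiceType) (E : set (set V)) :
  is_tree E -> infinite_set [set: V] -> E !=set0.
Proof.
move=> [_ tree] V_inf.
have [x _] := infinite_setN0 V_inf.
have [y yNx] : exists y, y <> x.
  apply: contrapT => all_x; apply: V_inf.
  apply: (sub_finite_set _ (finite_set1 x)) => y _ /=.
  by apply: contrapT => yNx; apply: all_x; exists y.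
have [[|z p] [[/andP[+ _] +] _]] := tree x y; first by move=> _ /= /esym.
by move=> /= /andP[/set_mem xz _] _; exists [set x; z].
Qed.

(** A simple path from [o] never returns to [o]. If its last edge contains [o], then that edge
    leaves [o], and it is the only edge of the path. *)
Lemma generation_root_edge (V : choiceType) (E : set (set V)) (o x : V) :
  E [set o; x] -> x <> o -> generation E o [set o; x] = 1%N.
(* [xgetP] leaves two cases: the chosen path ends with the edge, or no path does, which [[:: x]]
   refutes. *)
Proof.
move=> Eox xNo; rewrite /generation; case: xgetP => [_ -> | /(_ [:: x]) []].
  case=> /andP[_ uniq_p] [q [y [def_p ox]]]; move: uniq_p; rewrite def_p.
  rewrite /= mem_rcons inE negb_or => /andP[/andP[/eqP oNy oNq] _].
  have : [set last o q; y] o by rewrite -ox; left.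
  case=> [/= o_last|/= oy]; last by rewrite oy in oNy.
  case: q oNq o_last {def_p ox} => //= z q oNq o_last.
  by move: oNq; rewrite {1}o_last mem_last.
split; last by exists [::], x.
rewrite /simple_path /= andbT inE; apply/and3P; split=> //.
  by rewrite /adj; apply/mem_set.
by rewrite eq_sym; apply/eqP.
Qed.

Lemma generation_Gamma_oo0 (V : choiceType) (E : set (set V)) (o : V)
    (gamma : nat -> set V) :
  Gamma_oo E o gamma -> generation E o (gamma 0%N) = 1%N.
Proof.
case=> -[v [v0 v_inj v_edge]] _; have [Eg def_g] := v_edge 0%N.
move: Eg; rewrite def_g v0 => Eg; apply: generation_root_edge => //.
by rewrite -v0 => /v_inj.
Qed.

Lemma energy_oo_ge0 (R : realType) (V : choiceType) (E : set (set V))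
    (sigma rho : set V -> R) :
  E !=set0 -> (forall e, E e -> 0 <= sigma e) -> (forall e, E e -> 0 <= rho e) ->
  (0 <= energy_oo E sigma rho)%E.
Proof.
move=> [e Ee] s_ge0 r_ge0; apply: le_ereal_sup_tmp.
exists (sigma e * rho e)%:E; first by exists e.
by rewrite lee_fin mulr_ge0 ?s_ge0 ?r_ge0.
Qed.

Section Modulus.
Variables (R : realType) (V : choiceType) (E : set (set V)).
Variables (sigma : set V -> R) (Gamma : set (nat -> set V)).
Hypothesis sigma_gt0 : forall e, E e -> 0 < sigma e.
Hypothesis Gamma_edge : forall gamma i, Gamma gamma -> E (gamma i).

Let sigmaV_ge0 e : E e -> 0 <= (sigma e)^-1.
Proof. by move=> /sigma_gt0/ltW; rewrite invr_ge0. Qed.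

Lemma Adm_length_le_energy (rho : set V -> R) (r : R) (gamma : nat -> set V) :
  Adm E Gamma rho -> energy_oo E sigma rho = r%:E -> Gamma gamma ->
  (1 <= r%:E * path_length (fun e => ((sigma e)^-1)%R) gamma)%E.
Proof.
move=> [rho_ge0 adm] en Gg; apply: (le_trans (adm _ Gg)).
rewrite -path_length_scale => [|i]; last exact: sigmaV_ge0 (Gamma_edge i _).
apply: le_path_length => i; have Eg := Gamma_edge i Gg.
(* On an edge, [rho <= r / sigma] says that one term of the supremum defining the energy is at most
   [r]. *)
rewrite rho_ge0// ler_pdivlMr ?sigma_gt0// mulrC -lee_fin -en.
by apply: ereal_sup_ubound; exists (gamma i).
Qed.

Lemma Mod_oo_le (c : R) : 0 <= c ->
  (forall gamma, Gamma gamma ->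
    (1 <= c%:E * path_length (fun e => ((sigma e)^-1)%R) gamma)%E) ->
  (Mod_oo E sigma Gamma <= c%:E)%E.
Proof.
move=> c_ge0 c_len; apply: ge_ereal_inf.
exists (energy_oo E sigma (fun e => c * (sigma e)^-1)).
  exists (fun e => c * (sigma e)^-1) => //; split=> [e Ee|gamma Gg].
    by rewrite mulr_ge0 ?sigmaV_ge0.
  by rewrite path_length_scale ?c_len// => i; exact: sigmaV_ge0 (Gamma_edge i _).
apply: ge_ereal_sup => _ [e Ee <-].
by rewrite mulrCA divff ?mulr1// gt_eqF ?sigma_gt0.
Qed.

Lemma Mod_oo_ge0 : E !=set0 -> (0 <= Mod_oo E sigma Gamma)%E.
Proof.
move=> E0; apply: le_ereal_inf_tmp => _ [rho [rho_ge0 _] <-].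
by apply: energy_oo_ge0 => // e /sigma_gt0/ltW.
Qed.

(** An infimum equal to [+oo] forces every path length to be [+oo], so [c / sigma] is admissible for
    each [c > 0]. An empty [Gamma] falls under this case. *)
Lemma Mod_oo_eq0 : E !=set0 ->
  family_length (fun e => (sigma e)^-1) Gamma = +oo%E ->
  Mod_oo E sigma Gamma = 0%E.
Proof.
move=> E0 /ereal_inf_pinfty l_oo.
apply/eqP; rewrite eq_le Mod_oo_ge0// andbT.
apply/lee_addgt0Pr => c c_gt0; rewrite add0e.
apply: Mod_oo_le => [|gamma Gg]; first exact: ltW.
by rewrite (l_oo (path_length _ gamma)) ?gt0_muley ?lte_fin ?leey//; exists gamma.
Qed.

Lemma Mod_oo_eqV (l : R) : E !=set0 -> 0 < l ->
  family_length (fun e => (sigma e)^-1) Gamma = l%:E ->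
  Mod_oo E sigma Gamma = (l^-1)%:E.
Proof.
move=> E0 l_gt0 def_l.
have le_l gamma : Gamma gamma ->
    (l%:E <= path_length (fun e => ((sigma e)^-1)%R) gamma)%E.
  by move=> Gg; rewrite -def_l; apply: ereal_inf_lbound; exists gamma.
apply/eqP; rewrite eq_le; apply/andP; split.
  apply: Mod_oo_le => [|gamma Gg]; first by rewrite invr_ge0 ltW.
  by rewrite lee_pdivlMl// mule1 le_l.
apply: le_ereal_inf_tmp => _ [rho adm <-].
have := energy_oo_ge0 E0 (fun e Ee => ltW (sigma_gt0 Ee)) adm.1.
case en: (energy_oo E sigma rho) => [r| |] //; rewrite ?leey// lee_fin => r_ge0.
have len_ge gamma := Adm_length_le_energy (gamma := gamma) adm en.
(* The empty family has length [+oo], which is not [l]. *)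
have [gamma0 G0] : Gamma !=set0.
  apply/set0P/eqP => G0; move: def_l.
  by rewrite /family_length G0 image_set0 ereal_inf0.
(* With [r = 0] the bound would read [1 <= 0], even along a path of infinite length, because
   [0 * +oo = 0]. *)
have r_gt0 : 0 < r.
  rewrite lt_neqAle r_ge0 andbT eq_sym; apply/eqP => r0.
  by have := len_ge _ G0; rewrite r0 mul0e lee_fin ler10.
(* Inverting to [r^-1 <= l] puts the infimum on the right, where it suffices to bound each path
   length from below. *)
rewrite lee_fin invf_ple ?posrE// -lee_fin -def_l.
apply: le_ereal_inf_tmp => _ [gamma Gg <-].
by rewrite -[X in (X <= _)%E]mule1 lee_pdivrMl// len_ge.
Qed.

End Modulus.

Lemma radial_family_length_gt0 (R : realType) (V : choiceType)
    (E : set (set V)) (sigma : set V -> R) (o : V) :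
  (forall e, E e -> 0 < sigma e) -> radially_symmetric_weight E o sigma ->
  (0 < family_length (fun e => ((sigma e)^-1)%R) (Gamma_oo E o))%E.
Proof.
move=> sigma_gt0 sigma_radial.
have [->|/set0P[gamma0 G0]] := eqVneq (Gamma_oo E o) set0.
  by rewrite /family_length image_set0 ereal_inf0.
have s0_gt0 := sigma_gt0 _ (Gamma_oo_edge 0 G0).
apply: (@lt_le_trans _ _ ((sigma (gamma0 0%N))^-1)%:E).
  by rewrite lte_fin invr_gt0.
apply: le_ereal_inf_tmp => _ [gamma Gg <-].
(* Both first edges have generation 1, so one bound, taken from [gamma0], serves all paths. *)
rewrite (sigma_radial _ (gamma 0%N)) ?generation_Gamma_oo0//;
  [|exact: Gamma_oo_edge G0|exact: Gamma_oo_edge Gg].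
apply: (path_length_ge_first (f := fun e => (sigma e)^-1)) => i.
by rewrite invr_ge0 ltW ?sigma_gt0//; exact: (Gamma_oo_edge i Gg).
Qed.

Theorem theorem7 (R : realType) (V : choiceType) (E : set (set V))
    (sigma : set V -> R) (o : V)
    (sigma_gt0 : forall e, E e -> 0 < sigma e)
    (G_radial : radially_symmetric_tree E o)
    (sigma_radial : radially_symmetric_weight E o sigma) :
  let l := family_length (fun e => (sigma e)^-1) (Gamma_oo E o) in
  Mod_oo E sigma (Gamma_oo E o) =
    if (l < +oo)%E then ((fine l)^-1)%:E else 0%E.
Proof.
move=> l; have [[tree V_inf _ _] _] := G_radial.
have E0 := infinite_tree_edge tree V_inf.
have G_edge gamma i := @Gamma_oo_edge V E o gamma i.
have : (0 < l)%E by exact: radial_family_length_gt0.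
(* Positivity rules out [-oo] and makes [r] invertible. *)
case def_l: l => [r| |] // r_gt0.
  by rewrite ltry /=; exact: Mod_oo_eqV.
by rewrite ltxx; exact: Mod_oo_eq0.
Qed.
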